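(* Let $d\ge1$ and let $\mathcal{F}\subseteq\binom{\mathbb{N}}{d}$ be a finite family. Then $\mathrm{Inc}(\mathcal{C}(\mathcal{F}))\subseteq\mathcal{C}(\mathrm{Inc}(\mathcal{F}))$.
   Context: $\mathbb{N}=\{1,2,3,\dots\}$. For $d\ge1$, $\binom{\mathbb{N}}{d}$ is the set of $d$-element subsets of $\mathbb{N}$; an element is written $\mathbf{u}=(u_1,\ldots,u_d)$ with $u_1<\cdots<u_d$. The squashed order on $\binom{\mathbb{N}}{d}$: $\mathbf{u}<\mathbf{v}$ iff the largest element of the symmetric difference $(\mathbf{u}\setminus\mathbf{v})\cup(\mathbf{v}\setminus\mathbf{u})$ belongs to $\mathbf{v}$. For a finite family $\mathcal{F}\subseteq\binom{\mathbb{N}}{d}$, its compression $\mathcal{C}(\mathcal{F})$ is the set of the $|\mathcal{F}|$ smallest elements of $\binom{\mathbb{N}}{d}$ in the squashed order. Let $\mathrm{Inc}_1$ be the set of maps $\pi\colon\mathbb{N}\to\mathbb{N}$ with $\pi(j)<\pi(j+1)$ and $\pi(j)\le j+1$ for all $j\ge1$, acting by $\pi(\mathbf{u})=(\pi(u_1),\ldots,\pi(u_d))$. For $\mathcal{F}\subseteq\binom{\mathbb{N}}{d}$, $\mathrm{Inc}(\mathcal{F})=\{\pi(\mathbf{u})\mid \mathbf{u}\in\mathcal{F},\ \pi\in\mathrm{Inc}_1\}$ (finite when $\mathcal{F}$ is finite). *)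

(* Defs.v *)
From mathcomp Require Import all_boot.
Set Implicit Arguments. Unset Strict Implicit. Unset Printing Implicit Defensive.

(* A d-element subset of N = {1,2,...}, written u = (u_1 < ... < u_d),
   is represented by the strictly increasing list [u_1; ...; u_d]
   of positive naturals. *)
Definition dset (d : nat) (u : seq nat) : bool :=
  [&& sorted ltn u, size u == d & all (fun x => 0 < x) u].

Definition symdiff (u v : seq nat) : seq nat :=
  [seq x <- u | x \notin v] ++ [seq x <- v | x \notin u].

Definition sq_lt (u v : seq nat) : bool :=
  has (fun x => (x \notin u) && all (fun y => y <= x) (symdiff u v)) v.

(* C(F) for a family of cardinality n : u belongs to the set of the n smallest
   d-subsets in the squashed order, i.e. to some set S of n d-subsets such
   that every element of S is smaller than every d-subset outside S. *)
Definition compression (d n : nat) (u : seq nat) : Prop :=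
  exists S : seq (seq nat),
    [/\ uniq S, size S = n, all (dset d) S,
        (forall v w, v \in S -> dset d w -> w \notin S -> sq_lt v w)
      & u \in S].

Definition Inc1 (pi : nat -> nat) : Prop :=
  forall j, 0 < j -> [/\ 0 < pi j, pi j < pi j.+1 & pi j <= j.+1].

Definition IncP (P : seq nat -> Prop) (u : seq nat) : Prop :=
  exists v pi, [/\ P v, Inc1 pi & u = map pi v].

Definition enumerates (P : seq nat -> Prop) (s : seq (seq nat)) : Prop :=
  uniq s /\ forall u, u \in s <-> P u.

(* Main.v *)
Require Import Defs.
From mathcomp Require Import all_boot zify.
Set Implicit Arguments. Unset Strict Implicit. Unset Printing Implicit Defensive.

(** The squashed order on d-sets is the order of the combinadic rank
    rk u = sum_i C(u_i - 1, i), and Inc(u) consists of the d + 1 sequences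
    obtained from u by adding 1 to all entries from some position on, the largest
    being u + 1. It thus suffices to show that |F| > rk u implies
    |Inc(F)| > rk (u + 1).

    Reading u as the monomial with exponents u_1 - 1, u_2 - u_1 - 1, ..., the
    increments multiply by a variable or by 1, so this is a form of Macaulay's
    theorem, and Frankl's proof of Kruskal-Katona applies. Sliding F down along
    the lines u + Z (1,...,1,0,...,0) does not enlarge Inc(F), so F may be assumed
    stable under u |-> u - (1,...,1,0,...,0) when u_1 > 1. Let
    A = {u - 1 : u in F, u_1 > 1} and
    B = {(u_2 - 1, ..., u_d - 1) : u in F, u_1 = 1}. Always
    |Inc(F)| >= |F| + |Inc(B)|; stability gives Inc(A) included in F, which bounds
    |A| from above, hence |B| from below, and induction applies to A and B. *)

(** * Lists representing d-sets *)

Lemma dsetP d u :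
  reflect [/\ size u = d, forall l, l < d -> 0 < nth 0 u l
            & forall l, l.+1 < d -> nth 0 u l < nth 0 u l.+1] (dset d u).
Proof.
apply: (iffP and3P) => [[/(sortedP 0) us /eqP <- /(all_nthP 0) up]|[<- up us]].
  by split.
by split=> //; [apply/(sortedP 0) | apply/(all_nthP 0)].
Qed.

Lemma dset_size d u : dset d u -> size u = d.
Proof. by case/dsetP. Qed.

Lemma dset_nth_ge d u l : dset d u -> l < d -> nth 0 u 0 + l <= nth 0 u l.
Proof.
case/dsetP=> _ _ us; elim: l => [|l IH] ld; first by rewrite addn0.
by have := IH (ltnW ld); have := us _ ld; lia.
Qed.

(** The squashed order looks at the largest entry first, so the inductions below peel off the last
    entry. The bound [d < a] makes the binomial ['C(a.-1, d)] positive. *)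
Lemma dset_rcons d u a : dset d.+1 (rcons u a) ->
  [/\ dset d u, 0 < a, all (fun x => x < a) u & d < a].
Proof.
rewrite /dset size_rcons eqSS all_rcons.
case/and3P=> s /eqP du /andP[a0 up].
have sa : all (ltn^~ a) u.
  have := s; rewrite -cats1 sorted_pairwise; last exact: ltn_trans.
  by rewrite pairwise_cat allrel1r; case/andP.
split=> //.
  apply/and3P; split=> //; last exact/eqP.
  by have := s; rewrite -cats1; case/cat_sorted2.
have D : dset d.+1 (rcons u a).
  by rewrite /dset size_rcons s du eqxx all_rcons a0 up.
have := dset_nth_ge D (ltnSn d); rewrite [X in _ <= X]nth_rcons du ltnn eqxx.
by have [_ /(_ 0 isT) + _] := dsetP _ _ D; lia.
Qed.

Lemma rcons_dset d u a :
  dset d u -> 0 < a -> all (fun x => x < a) u -> dset d.+1 (rcons u a).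
Proof.
case/dsetP=> du up us a0 ua; apply/dsetP; split.
- by rewrite size_rcons du.
- move=> l ld; rewrite nth_rcons du; case: (ltngtP l d) => [ld'|ld'|_] //; [exact: up|lia].
move=> l; rewrite ltnS => ld; rewrite !nth_rcons du ld.
case: (ltngtP l.+1 d) => [||e]; [exact: us | lia |].
by move/(all_nthP 0): ua; apply; rewrite du.
Qed.

Lemma dset_map_succn d u : dset d u -> dset d (map succn u).
Proof.
case/dsetP=> du up us; apply/dsetP; rewrite size_map; split=> // l ld.
  by rewrite (nth_map 0) // du.
by rewrite !(nth_map 0) ?du ?ltnS ?us // ltnW.
Qed.

(** * The squashed order *)

Lemma sq_lt_rcons_ltn u w a b : all (fun x => x < a) u ->
  all (fun x => x < b) w -> a < b -> sq_lt (rcons u a) (rcons w b).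
Proof.
move=> /allP ua /allP wb ab; apply/hasP; exists b.
  by rewrite mem_rcons mem_head.
apply/andP; split.
  rewrite mem_rcons inE negb_or; apply/andP; split; first by lia.
  by apply/negP=> /ua; lia.
apply/allP=> x; rewrite mem_cat !mem_filter !mem_rcons !inE.
case/orP=> /andP[_ /orP[/eqP ->|h]] //; first exact: ltnW.
  by have := ua _ h; lia.
exact/ltnW/wb.
Qed.

Lemma sq_lt_rcons u w a : all (fun x => x < a) w ->
  sq_lt u w -> sq_lt (rcons u a) (rcons w a).
Proof.
move=> /allP wa /hasP[x xw /andP[xu /allP xm]]; apply/hasP; exists x.
  by rewrite mem_rcons inE xw orbT.
rewrite mem_rcons inE negb_or xu andbT; apply/andP; split.
  by have := wa _ xw; lia.
apply/allP=> y; rewrite mem_cat !mem_filter !mem_rcons !inE !negb_or => yd.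
apply: xm; rewrite mem_cat !mem_filter.
by case/orP: yd => /andP[/andP[/negPf -> ->]] /= ->; rewrite ?orbT.
Qed.

Lemma sq_lt_irr u : sq_lt u u = false.
Proof. by apply/negP=> /hasP[x ->]. Qed.

Lemma sq_lt_asym u w : sq_lt u w -> sq_lt w u -> False.
Proof.
case/hasP=> x xw /andP[xu /allP xm] /hasP[y yu /andP[yw /allP ym]].
have : x = y.
  apply/eqP; rewrite eqn_leq; apply/andP; split; [apply: ym|apply: xm].
    by rewrite mem_cat !mem_filter xu xw.
  by rewrite mem_cat !mem_filter yw yu.
by move=> e; rewrite e yu in xu.
Qed.

(** * The combinadic rank *)

Definition rk (u : seq nat) := \sum_(l < size u) 'C((nth 0 u l).-1, l.+1).

Lemma rk_rcons u a : rk (rcons u a) = rk u + 'C(a.-1, (size u).+1).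
Proof.
rewrite /rk size_rcons big_ord_recr /= nth_rcons ltnn eqxx; congr (_ + _).
by apply: eq_bigr => l _; rewrite nth_rcons ltn_ord.
Qed.

(** The right-hand side counts the d-subsets of {1, ..., a-1}, an initial segment containing [u].
    The induction removes the largest entry [b] and applies Pascal's rule at [b]. *)
Lemma rk_ltn_bin d u a : 0 < a -> dset d u -> all (fun x => x < a) u -> d < a ->
  rk u < 'C(a.-1, d).
Proof.
elim: d u a => [|d IH] u a a0 du ua da.
  by rewrite /rk (dset_size du) big_ord0 bin0.
case/lastP: u du ua => [|u b] du; first by have := dset_size du.
have [du' b0 ub bd] := dset_rcons du.
rewrite all_rcons rk_rcons => /andP[ba _]; rewrite (dset_size du').
have := IH _ _ b0 du' ub bd.
have : 'C(b, d.+1) <= 'C(a.-1, d.+1) by apply: leq_bin2l; lia.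
by case: b b0 {du ub bd ba} => // b _; rewrite binS /=; lia.
Qed.

Lemma rk_rcons_ltn d u w a b : dset d u -> all (fun x => x < a) u ->
  size w = d -> d < a -> a < b -> rk (rcons u a) < rk (rcons w b).
Proof.
move=> du ua dw da ab; rewrite !rk_rcons dw (dset_size du).
have a0 : 0 < a by lia.
have := rk_ltn_bin a0 du ua da.
have : 'C(a, d.+1) <= 'C(b.-1, d.+1) by apply: leq_bin2l; lia.
by case: a a0 {ua da ab} => // a _; rewrite binS /=; lia.
Qed.

Lemma rk_rcons_leq d u w a b : dset d.+1 (rcons u a) -> dset d.+1 (rcons w b) ->
  rk (rcons u a) <= rk (rcons w b) -> a < b \/ a = b /\ rk u <= rk w.
Proof.
move=> /dset_rcons[du _ ua da] /dset_rcons[dw _ wb db] le.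
have [ab|ba|ab] := ltngtP a b; [by left | | right; split=> //].
  by have := rk_rcons_ltn dw wb (dset_size du) db ba; lia.
by move: le; rewrite ab !rk_rcons (dset_size du) (dset_size dw); lia.
Qed.

Lemma rk_inj d u w : dset d u -> dset d w -> rk u = rk w -> u = w.
Proof.
elim: d u w => [|d IH] u w du dw.
  by have /size0nil -> := dset_size du; have /size0nil -> := dset_size dw.
case/lastP: u du => [|u a] du; first by have := dset_size du.
case/lastP: w dw => [|w b] dw; first by have := dset_size dw.
move=> e; have [du' _ ua da] := dset_rcons du; have [dw' _ wb db] := dset_rcons dw.
case: (rk_rcons_leq du dw); first by rewrite e.
  by have := rk_rcons_ltn du' ua (dset_size dw') da; rewrite e => /[apply]; rewrite ltnn.
move=> [ab _]; subst b; congr rcons; apply: IH => //.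
by move: e; rewrite !rk_rcons (dset_size du') (dset_size dw'); lia.
Qed.

Lemma rk_sq_lt d u w : dset d u -> dset d w -> rk u < rk w -> sq_lt u w.
Proof.
elim: d u w => [|d IH] u w du dw.
  by have /size0nil -> := dset_size du; have /size0nil -> := dset_size dw; rewrite ltnn.
case/lastP: u du => [|u a] du; first by have := dset_size du.
case/lastP: w dw => [|w b] dw; first by have := dset_size dw.
move=> lt; have [du' _ ua da] := dset_rcons du; have [dw' _ wb db] := dset_rcons dw.
case: (rk_rcons_leq du dw (ltnW lt)); first exact: sq_lt_rcons_ltn.
move=> [ab _]; subst b; apply: sq_lt_rcons => //; apply: IH => //.
by move: lt; rewrite !rk_rcons (dset_size du') (dset_size dw'); lia.
Qed.

Lemma sq_lt_rk d u w : dset d u -> dset d w -> sq_lt u w -> rk u < rk w.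
Proof.
move=> du dw uw; case: ltngtP => // [/(rk_sq_lt dw du) wu|/(rk_inj du dw) e].
  by case: (sq_lt_asym uw wu).
by rewrite e sq_lt_irr in uw.
Qed.

(** The shift preserves the comparison of the largest entries and, when these agree, by induction
    that of the remaining ones. *)
Lemma rk_map_succn_ltn d u w : dset d u -> dset d w -> rk u < rk w ->
  rk (map succn u) < rk (map succn w).
Proof.
elim: d u w => [|d IH] u w du dw.
  by have /size0nil -> := dset_size du; have /size0nil -> := dset_size dw; rewrite ltnn.
case/lastP: u du => [|u a] du; first by have := dset_size du.
case/lastP: w dw => [|w b] dw; first by have := dset_size dw.
move=> lt; have [du' _ ua da] := dset_rcons du; have [dw' _ wb db] := dset_rcons dw.
case: (rk_rcons_leq du dw (ltnW lt)) => [ab|[ab _]]; rewrite !map_rcons.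
  apply: (@rk_rcons_ltn d) => //; try lia; first exact: dset_map_succn.
    by rewrite all_map.
  by rewrite size_map (dset_size dw').
subst b; have := IH _ _ du' dw'; move: lt.
by rewrite !rk_rcons !size_map (dset_size du') (dset_size dw'); lia.
Qed.

Lemma rk_map_succn_leq d u w : dset d u -> dset d w -> rk u <= rk w ->
  rk (map succn u) <= rk (map succn w).
Proof.
move=> du dw; rewrite leq_eqVlt => /orP[/eqP/(rk_inj du dw) -> //|lt].
exact/ltnW/(rk_map_succn_ltn du dw).
Qed.

(** Greedy expansion: the largest entry is [x.+1] for the largest [x] whose top binomial is at most
    [n]. By maximality and Pascal's rule the remainder is less than ['C(x, d.+1)], which forces its
    own entries below [x.+1]. *)
Lemma rk_surj d n : 0 < d -> exists2 u, dset d u & rk u = n.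
Proof.
case: d => // d _; elim: d n => [|d IH] n.
  exists [:: n.+1] => //.
  by rewrite /rk big_ord_recl big_ord0 addn0 bin1.
have ex0 : exists x, 'C(x, d.+2) <= n by exists 0.
(* The maximum exists because ['C(x, d.+2)] grows by at least 1 at each step from [x = d.+1] on. *)
have ub x : 'C(x, d.+2) <= n -> x <= n + d.+2.
  move=> xn; rewrite leqNgt; apply/negP=> lt.
  suff : x - d.+1 <= 'C(x, d.+2) by lia.
  elim: x {xn lt} => // x IHx; rewrite binS.
  have [xd|xd] := ltnP x d.+1; first by lia.
  have : 0 < 'C(x, d.+1) by rewrite bin_gt0.
  by lia.
case: (ex_maxnP ex0 ub) => x xn xmax.
have xn' : n < 'C(x.+1, d.+2) by rewrite ltnNge; apply/negP=> /xmax; rewrite ltnn.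
have [u du rku] := IH (n - 'C(x, d.+2)).
have rkx : rk u < 'C(x, d.+1) by move: xn'; rewrite binS; lia.
exists (rcons u x.+1); last by rewrite rk_rcons (dset_size du) rku /=; lia.
apply: rcons_dset => //.
case/lastP: u du rkx {rku} => [|u a] du; first by have := dset_size du.
have [du' a0 ua da] := dset_rcons du.
rewrite rk_rcons (dset_size du') => rkx.
have ax : a < x.+1.
  rewrite ltnNge; apply/negP=> xa.
  have : 'C(x, d.+1) <= 'C(a.-1, d.+1) by apply: leq_bin2l; lia.
  by lia.
by rewrite all_rcons ax; apply/allP=> y /(allP ua); lia.
Qed.

(** * Compressions as initial segments of ranks *)

Lemma compression_rk d n u : 0 < d -> compression d n u -> dset d u /\ rk u < n.
Proof.
move=> d0 [S [uS <- /allP dS ltS uSin]]; have du := dS _ uSin; split=> //.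
rewrite -[X in X <= _](size_iota 0) -(size_map rk); apply: uniq_leq_size.
  exact: iota_uniq.
move=> r; rewrite mem_iota add0n => /= ru.
(* A d-set of rank at most [rk u] cannot lie outside [S], since it would then come after [u]. So [S]
   realises all of the ranks 0, ..., [rk u]. *)
have [w dw rkw] := rk_surj r d0; apply/mapP; exists w => //.
by apply: contraLR ru => wS; have := sq_lt_rk du dw (ltS _ _ uSin dw wS); lia.
Qed.

Lemma rk_compression d n u : 0 < d -> dset d u -> rk u < n -> compression d n u.
Proof.
move=> d0 du un.
have [S dS rkS] : exists2 S, all (dset d) S & map rk S = iota 0 n.
  elim: n {u du un} => [|n [S dS rkS]]; first by exists [::].
  have [w dw rkw] := rk_surj n d0.
  exists (rcons S w); first by rewrite all_rcons dw.
  by rewrite map_rcons rkS rkw -addn1 iotaD cats1.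
have memS w : dset d w -> (w \in S) = (rk w < n).
  move=> dw; rewrite -[rk w < n](mem_iota 0 n (rk w)) -rkS.
  apply/idP/idP => [/map_f -> //|/mapP[w' w'S]].
  by move/(rk_inj dw (allP dS _ w'S)) => ->.
exists S; split=> //.
- by apply: (@map_uniq _ _ rk); rewrite rkS iota_uniq.
- by rewrite -(size_map rk) rkS size_iota.
- move=> v w vS dw; have dv := allP dS _ vS.
  move: vS; rewrite !memS // => vn wn; apply: (rk_sq_lt dv dw); lia.
by rewrite memS.
Qed.

(** * Increasing maps *)

(** Positions count from 0: [j = 0] shifts the whole set and [j = size u] leaves it fixed. *)
Definition inc (j : nat) (u : seq nat) :=
  mkseq (fun l => if j <= l then (nth 0 u l).+1 else nth 0 u l) (size u).

Lemma size_inc j u : size (inc j u) = size u.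
Proof. exact: size_mkseq. Qed.

Lemma nth_inc j u l : l < size u ->
  nth 0 (inc j u) l = if j <= l then (nth 0 u l).+1 else nth 0 u l.
Proof. by move=> lu; rewrite nth_mkseq. Qed.

Lemma inc0 u : inc 0 u = map succn u.
Proof.
apply: (@eq_from_nth _ 0) => [|l]; rewrite size_inc ?size_map // => lu.
by rewrite nth_inc // (nth_map 0).
Qed.

Lemma inc_inj d j u v : size u = d -> size v = d -> inc j u = inc j v -> u = v.
Proof.
move=> du dv e; apply: (@eq_from_nth _ 0) => [|l lu]; first by rewrite du dv.
have := congr1 (nth 0 ^~ l) e; rewrite !nth_inc ?dv -?du //.
by case: ifP => // _ [].
Qed.

Lemma dset_inc d j u : dset d u -> dset d (inc j u).
Proof.
case/dsetP=> du up us; apply/dsetP; rewrite size_inc; split=> // l ld.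
  by rewrite nth_inc ?du //; case: ifP => // _; apply: up.
by rewrite !nth_inc ?du //; try lia; have := us _ ld; case: ifP; case: ifP; lia.
Qed.

(** Duplicates are removed so that the size of the list is the cardinality of Inc(F). *)
Definition incs (F : seq (seq nat)) :=
  undup [seq inc j u | u <- F, j <- iota 0 (size u).+1].

Lemma mem_incs F w :
  reflect (exists u j, [/\ u \in F, j <= size u & w = inc j u]) (w \in incs F).
Proof.
rewrite mem_undup; apply: (iffP allpairsPdep) => [[u [j [uF jd ->]]]|[u [j [uF jd ->]]]].
  by exists u, j; split=> //; rewrite mem_iota in jd.
by exists u, j; split=> //; rewrite mem_iota.
Qed.

Lemma dset_incs d F : all (dset d) F -> all (dset d) (incs F).
Proof.
move=> /allP dF; apply/allP=> w /mem_incs[u [j [uF _ ->]]].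
exact/dset_inc/dF.
Qed.

(** * Compression along a line *)

(** The number of unit steps by which a nonempty prefix of [u] can slide down with all entries still
    positive. *)
Definition hgt (u : seq nat) := (nth 0 u 0).-1.

Definition slide (i t : nat) (u : seq nat) :=
  mkseq (fun l => if l < i then nth 0 u l - t else nth 0 u l) (size u).

(* [u] is determined by the line [base i u] it lies on, in the direction
   (1,...,1,0,...,0) with [i] ones, and by its height on that line. *)
Definition base (i : nat) (u : seq nat) := slide i (hgt u) u.

Lemma size_slide i t u : size (slide i t u) = size u.
Proof. exact: size_mkseq. Qed.

Lemma nth_slide i t u l : l < size u ->
  nth 0 (slide i t u) l = if l < i then nth 0 u l - t else nth 0 u l.
Proof. by move=> lu; rewrite nth_mkseq. Qed.

Lemma dset_slide d i t u : dset d u -> t <= hgt u -> dset d (slide i t u).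
Proof.
move=> /[dup] D /dsetP[du up us] th; apply/dsetP; rewrite size_slide.
rewrite /hgt in th.
(* Every entry exceeds [t], so the truncated subtractions are exact. *)
have lo l : l < d -> t < nth 0 u l.
  by move=> ld; have := dset_nth_ge D ld; have := up 0; lia.
split=> // l ld.
  by rewrite nth_slide ?du //; have := lo _ ld; have := up _ ld; case: ifP; lia.
rewrite !nth_slide ?du; try lia; have := us _ ld.
by have := lo l; case: ifP; case: ifP; lia.
Qed.

Lemma hgt_slide d i t u : dset d u -> 0 < d -> 0 < i ->
  hgt (slide i t u) = hgt u - t.
Proof.
move=> /dset_size du d0 i0; rewrite /hgt nth_slide ?du // i0; lia.
Qed.

Lemma base_slide d i t u : dset d u -> 0 < d -> 0 < i -> t <= hgt u ->
  base i (slide i t u) = base i u.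
Proof.
move=> du d0 i0 th; have ds := dset_size du.
apply: (@eq_from_nth _ 0) => [|l]; rewrite !size_slide // => lu.
rewrite /base !nth_slide ?size_slide // (hgt_slide _ du d0 i0).
by case: (l < i); lia.
Qed.

Lemma base_hgt_inj d i u v : dset d u -> dset d v -> 0 < d ->
  base i u = base i v -> hgt u = hgt v -> u = v.
Proof.
move=> du dv d0 eb eh; have us := dset_size du; have vs := dset_size dv.
apply: (@eq_from_nth _ 0) => [|l lu]; first by rewrite us vs.
have := congr1 (nth 0 ^~ l) eb; rewrite /base !nth_slide ?vs -?us //.
case: ifP => // _; rewrite eh.
have ld : l < d by rewrite -us.
have := dset_nth_ge du ld; have := dset_nth_ge dv ld.
by move: eh; rewrite /hgt; lia.
Qed.

Lemma hgt_inc d j u : dset d u -> 0 < d -> hgt (inc j u) = hgt u + (j == 0).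
Proof.
move=> /dsetP[du up _] d0; rewrite /hgt nth_inc ?du // leqn0.
by case: ifP => _; have := up 0; lia.
Qed.

Lemma base_inc d i j u : dset d u -> 0 < d -> 0 < i -> 0 < j ->
  base i (inc j u) = inc j (base i u).
Proof.
move=> du d0 i0 j0; have ds := dset_size du.
apply: (@eq_from_nth _ 0) => [|l]; rewrite ?size_inc !size_slide ?size_inc // => lu.
rewrite /base nth_slide ?size_inc // [RHS]nth_inc ?size_slide // nth_slide // nth_inc //.
rewrite (hgt_inc _ du d0) /hgt; have := @dset_nth_ge d u l du; rewrite -ds => /(_ lu).
by case: eqP => [|_]; case: (l < i); case: (j <= l); lia.
Qed.

(** Raising all entries raises the height by 1, which returning to the base undoes on the first [i]
    entries only. Hence [inc 0] and [inc i] send a line to the same line, one unit of height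
    apart. *)
Lemma base_inc0 d i u : dset d u -> 0 < d -> 0 < i ->
  base i (inc 0 u) = inc i (base i u).
Proof.
move=> du d0 i0; have ds := dset_size du.
apply: (@eq_from_nth _ 0) => [|l]; rewrite ?size_inc !size_slide ?size_inc // => lu.
rewrite /base nth_slide ?size_inc // [RHS]nth_inc ?size_slide // nth_slide // nth_inc //.
rewrite (hgt_inc _ du d0) /hgt; have := @dset_nth_ge d u l du; rewrite -ds => /(_ lu).
by have [_ /(_ 0 d0) + _] := dsetP _ _ du; rewrite leq0n eqxx; case: (ltnP l i) => _ /=; lia.
Qed.

Section LineCompression.

Variables (d i : nat).
Hypotheses (d0 : 0 < d) (i0 : 0 < i).
Implicit Types F : seq (seq nat).

Definition line F z := [seq v <- F | base i v == z].

Definition lrank F u := count (fun v => hgt v < hgt u) (line F (base i u)).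

(** If [F] has k members on a line, they are moved to the heights 0, ..., k-1 of that line. *)
Definition lcomp F := [seq slide i (hgt u - lrank F u) u | u <- F].

Lemma mem_line F z v : (v \in line F z) = (base i v == z) && (v \in F).
Proof. exact: mem_filter. Qed.

Lemma line_hgt_uniq F z : uniq F -> all (dset d) F -> uniq (map hgt (line F z)).
Proof.
move=> uF /allP dF; rewrite map_inj_in_uniq ?filter_uniq //.
move=> u v; rewrite !mem_line => /andP[/eqP bu uF'] /andP[/eqP bv vF].
by apply: (@base_hgt_inj d i) => //; [exact: dF | exact: dF | rewrite bu bv].
Qed.

Lemma lrankE F u :
  lrank F u = size [seq k <- map hgt (line F (base i u)) | k < hgt u].
Proof. by rewrite size_filter count_map. Qed.

Lemma lrank_leq F u : uniq F -> all (dset d) F -> lrank F u <= hgt u.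
Proof.
move=> uF dF; rewrite lrankE -[X in _ <= X](size_iota 0); apply: uniq_leq_size.
  by rewrite filter_uniq // line_hgt_uniq.
by move=> k; rewrite mem_filter mem_iota => /andP[].
Qed.

(** Heights on a line are distinct, and the one just below [u] is vacant, so fewer than [hgt u]
    members lie below [u]. *)
Lemma lrank_ltn F u : uniq F -> all (dset d) F -> u \in F -> 0 < hgt u ->
  slide i 1 u \notin F -> lrank F u < hgt u.
Proof.
move=> uF dF uFin hu nF; have du := allP dF _ uFin.
rewrite lrankE; apply: (@leq_ltn_trans (size (iota 0 (hgt u).-1))); last first.
  by rewrite size_iota; lia.
apply: uniq_leq_size; first by rewrite filter_uniq // line_hgt_uniq.
move=> k; rewrite mem_filter mem_iota => /= /andP[ku /mapP[v]].
rewrite mem_line => /andP[/eqP bv vF] ek; rewrite add0n.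
suff : k != (hgt u).-1 by lia.
apply: contra nF => /eqP ku'; suff -> : slide i 1 u = v by [].
apply: (@base_hgt_inj d i) => //; [exact: dset_slide | exact: (allP dF) | |].
  by rewrite (base_slide du).
by rewrite (hgt_slide _ du) // -ek ku'; lia.
Qed.

Lemma lrank_mono F u v : v \in F -> base i v = base i u -> hgt v < hgt u ->
  lrank F v < lrank F u.
Proof.
move=> vF e vu; rewrite /lrank e.
have vl : v \in line F (base i u) by rewrite mem_line e eqxx.
elim: (line _ _) vl => //= x s IH; rewrite inE => /orP[/eqP <-|/IH].
  rewrite ltnn vu add0n add1n ltnS; apply: sub_count => w /=; lia.
have : (hgt x < hgt v) <= (hgt x < hgt u) by lia.
by lia.
Qed.

Lemma lrank_inj F u v : u \in F -> v \in F -> all (dset d) F ->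
  base i u = base i v -> lrank F u = lrank F v -> u = v.
Proof.
move=> uF vF /allP dF eb er.
apply: (base_hgt_inj (dF _ uF) (dF _ vF) d0 eb).
have [lt|lt|//] := ltngtP (hgt u) (hgt v).
  by have := lrank_mono uF eb lt; rewrite er ltnn.
by have := lrank_mono vF (esym eb) lt; rewrite er ltnn.
Qed.

Lemma lrank_size F u : u \in F -> lrank F u < size (line F (base i u)).
Proof.
move=> uF; have ul : u \in line F (base i u) by rewrite mem_line eqxx.
rewrite /lrank -(count_predC (fun v => hgt v < hgt u) (line _ _)).
rewrite -[X in X < _]addn0 ltn_add2l -has_count; apply/hasP; exists u => //=.
by rewrite ltnn.
Qed.

Section Elements.

Variable F : seq (seq nat).
Hypotheses (uF : uniq F) (dF : all (dset d) F).

Let cmp u := slide i (hgt u - lrank F u) u.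

Lemma dset_cmp u : u \in F -> dset d (cmp u).
Proof. by move=> uFin; apply: dset_slide (leq_subr _ _); apply: (allP dF). Qed.

Lemma hgt_cmp u : u \in F -> hgt (cmp u) = lrank F u.
Proof.
move=> uFin; rewrite (hgt_slide _ (allP dF _ uFin)) //.
by rewrite subKn // lrank_leq.
Qed.

Lemma base_cmp u : u \in F -> base i (cmp u) = base i u.
Proof.
by move=> uFin; rewrite (base_slide (allP dF _ uFin)) // leq_subr.
Qed.

Lemma all_dset_lcomp : all (dset d) (lcomp F).
Proof. by apply/allP=> _ /mapP[u uFin ->]; apply: dset_cmp. Qed.

Lemma lcomp_uniq : uniq (lcomp F).
Proof.
rewrite map_inj_in_uniq // => u v uFin vFin e.
apply: (lrank_inj uFin vFin dF); last by rewrite -!hgt_cmp // /cmp e.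
by rewrite -base_cmp // /cmp e; apply: base_cmp.
Qed.

Lemma lcomp_hgt w : w \in lcomp F -> hgt w < size (line F (base i w)).
Proof.
by case/mapP=> u uFin ->; rewrite hgt_cmp // base_cmp // lrank_size.
Qed.

(** The k members of a line have k distinct ranks below k, so every height below k is reached. *)
Lemma mem_lcomp w : dset d w -> hgt w < size (line F (base i w)) -> w \in lcomp F.
Proof.
move=> dw hw; set L := line F (base i w) in hw.
have LF u : u \in L -> base i u = base i w /\ u \in F.
  by rewrite mem_line => /andP[/eqP].
have [_ eqL] : (size (map (lrank F) L) = size (iota 0 (size L)))
     * (map (lrank F) L =i iota 0 (size L)).
  apply: uniq_min_size; last by rewrite size_iota size_map.
    rewrite map_inj_in_uniq ?filter_uniq // => u v /LF[bu uFin] /LF[bv vFin].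
    by apply: lrank_inj => //; rewrite bu bv.
  move=> r /mapP[u /LF[bu uFin] ->]; rewrite mem_iota /= add0n.
  by rewrite /L -bu lrank_size.
have : hgt w \in map (lrank F) L by rewrite eqL mem_iota.
case/mapP=> u /LF[bu uFin] eh; apply/mapP; exists u => //.
apply: (@base_hgt_inj d i) => //; first exact: dset_cmp.
  by rewrite base_cmp.
by rewrite hgt_cmp.
Qed.

End Elements.

Lemma size_lcomp F : size (lcomp F) = size F.
Proof. exact: size_map. Qed.

Hypothesis le_i_d : i <= d.

(** By [mem_lcomp] it is enough to find more members of [incs F] on the line of [inc j x] than the
    height of [inc j x]. For [j > 0] the height is that of [x] and [inc j] embeds the old line. For
    [j = 0] the height grows by 1, so one additional member is required. *)
Lemma incs_lcomp F : uniq F -> all (dset d) F ->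
  {subset incs (lcomp F) <= lcomp (incs F)}.
Proof.
move=> uF dF w /mem_incs[x [j [xT jx ->]]].
have dx : dset d x by apply: (allP (all_dset_lcomp dF)).
have dI := dset_incs dF; have uI : uniq (incs F) by apply: undup_uniq.
apply: mem_lcomp => //; first exact: dset_inc.
have hx := lcomp_hgt uF dF xT; set L := line F (base i x) in hx.
have LF u : u \in L -> base i u = base i x /\ u \in F.
  by rewrite mem_line => /andP[/eqP].
have memI k u : k <= d -> u \in F -> inc k u \in incs F.
  by move=> kd uFin; apply/mem_incs; exists u, k; rewrite (dset_size (allP dF _ uFin)).
have uL k : uniq (map (inc k) L).
  rewrite map_inj_in_uniq ?filter_uniq // => u v /LF[_ uFin] /LF[_ vFin].
  by apply: (@inc_inj d); apply: dset_size; apply: (allP dF).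
rewrite (hgt_inc _ dx) //; case: posnP => j0 /=; last first.
  rewrite addn0; apply: (leq_trans hx).
  rewrite -(size_map (inc j)); apply: uniq_leq_size => //.
  move=> _ /mapP[u /LF[bu uFin] ->]; rewrite mem_line memI //; last first.
    by rewrite -(dset_size dx).
  by rewrite (base_inc (allP dF _ uFin)) // (base_inc dx) // bu eqxx.
rewrite j0 (base_inc0 dx) //.
(* For the highest member [v], [inc 0 v] lies above all the [inc i u] on the target line and is the
   additional member. *)
have [v vL vmax] : exists2 v, v \in L & forall u, u \in L -> hgt u <= hgt v.
  have : 0 < size L by lia.
  elim: (L) => // a s IH _; case: (posnP (size s)) => [/size0nil ->|/IH[v vs vm]].
    by exists a; rewrite ?mem_head // => u; rewrite inE => /eqP ->.
  have [av|va] := leqP (hgt a) (hgt v).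
    exists v; first by rewrite inE vs orbT.
    by move=> u; rewrite inE => /orP[/eqP ->|/vm].
  exists a; first exact: mem_head.
  by move=> u; rewrite inE => /orP[/eqP ->|/vm] //; lia.
have [bv vFin] := LF _ vL.
apply: (@leq_trans (size (inc 0 v :: map (inc i) L))).
  by rewrite /= size_map; lia.
apply: uniq_leq_size => [|_ /predU1P[->|/mapP[u /LF[bu uFin] ->]]].
- rewrite /= uL andbT; apply/negP=> /mapP[u uL' e].
  have [_ uFin] := LF _ uL'; have := congr1 hgt e.
  rewrite !(@hgt_inc d) ?(allP dF) //=; have := vmax _ uL'; lia.
- by rewrite mem_line memI // (base_inc0 (allP dF _ vFin)) // bv eqxx.
by rewrite mem_line memI // (base_inc (allP dF _ uFin)) // bu eqxx.
Qed.

Lemma size_incs_lcomp F : uniq F -> all (dset d) F ->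
  size (incs (lcomp F)) <= size (incs F).
Proof.
move=> uF dF; rewrite -[X in _ <= X]size_lcomp; apply: uniq_leq_size.
  exact: undup_uniq.
exact: incs_lcomp.
Qed.

(** The measure showing that repeated compression terminates: no height rises, and that of [u]
    drops. *)
Lemma sum_hgt_lcomp F u : uniq F -> all (dset d) F -> u \in F -> 0 < hgt u ->
  slide i 1 u \notin F -> \sum_(v <- lcomp F) hgt v < \sum_(v <- F) hgt v.
Proof.
move=> uF dF uFin hu nF; rewrite big_map (bigD1_seq u) //= [X in _ < X](bigD1_seq u) //=.
rewrite -addSn leq_add ?hgt_cmp ?lrank_ltn //.
rewrite !(big_seq_cond (fun v => v != u)); apply: leq_sum => v /andP[vF _].
by rewrite hgt_cmp // lrank_leq.
Qed.

End LineCompression.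

(** * The lower bound for the number of increments *)

(** Pascal's rule in each term. The lower binomials are 1 at the first entry and sum to the rank of
    the tail over the others. *)
Lemma rk_map_succn d u : dset d.+1 u ->
  rk (map succn u) = rk u + (rk (behead u)).+1.
Proof.
case/dsetP=> du up _; rewrite /rk size_map size_behead du /=.
rewrite (eq_bigr (fun l : 'I_d.+1 => 'C((nth 0 u l).-1, l.+1) + 'C((nth 0 u l).-1, l))).
  rewrite big_split /= [X in _ + X]big_ord_recl /= bin0 add1n.
  by congr (_ + _.+1); apply: eq_bigr => l _; rewrite nth_behead.
move=> l _; rewrite (nth_map 0) ?du //=.
by have := up l (ltn_ord l); case: (nth 0 u l) => // x _; rewrite binS.
Qed.

Lemma rk_leq_nth u w : size u = size w ->
  (forall l, l < size u -> nth 0 u l <= nth 0 w l) -> rk u <= rk w.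
Proof.
move=> e le; rewrite /rk -e; apply: leq_sum => l _; apply: leq_bin2l.
by have := le l (ltn_ord l); lia.
Qed.

Lemma hgt_gt0 u l d : dset d u -> 0 < hgt u -> l < d -> 1 < nth 0 u l.
Proof. by rewrite /hgt => du hu ld; have := dset_nth_ge du ld; lia. Qed.

Lemma map_predn_dset d u : dset d u -> 0 < hgt u -> dset d (map predn u).
Proof.
move=> D hu; have lo l := @hgt_gt0 u l d D hu; case/dsetP: D => du up us.
apply/dsetP; rewrite size_map; split=> // l ld.
  by rewrite (nth_map 0) ?du //; have := lo _ ld; lia.
rewrite !(nth_map 0) ?du //; try lia.
by have := lo _ ld; have := us _ ld; have := up l; lia.
Qed.

Lemma map_prednK u : all (fun x => 0 < x) u -> map succn (map predn u) = u.
Proof. by elim: u => //= x u IH /andP[x0 /IH ->]; rewrite prednK. Qed.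

Definition ptail (u : seq nat) := map predn (behead u).

Lemma ptail_dset d u : dset d.+1 u -> dset d (ptail u).
Proof.
move=> D; have lo l := @dset_nth_ge _ u l D; case/dsetP: D => du up us.
apply/dsetP; rewrite size_map size_behead du; split=> // l ld.
  rewrite (nth_map 0) ?size_behead ?du // nth_behead.
  by have := lo l.+1; have := up 0; lia.
rewrite !(nth_map 0) ?size_behead ?du // ?nth_behead; try lia.
by have := us l.+1; have := up l.+1; lia.
Qed.

Lemma dset_pos d u : dset d u -> all (fun x => 0 < x) u.
Proof. by case/and3P. Qed.

Lemma ptailK d u : dset d.+1 u -> map succn (ptail u) = behead u.
Proof.
by move/dset_pos; case: u => //= x u /andP[_]; apply: map_prednK.
Qed.

(** * Stable families and their upper and lower parts *)

Definition stable d (F : seq (seq nat)) :=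
  all (fun i => all (fun u => (0 < hgt u) ==> (slide i 1 u \in F)) F) (iota 1 d).

Section Stable.

Variables (d : nat) (F : seq (seq nat)).
Hypotheses (uF : uniq F) (dF : all (dset d.+1) F).

Let A := [seq map predn u | u <- F & 0 < hgt u].
Let B := [seq ptail u | u <- F & hgt u == 0].

Lemma low_part_cons u : u \in F -> hgt u = 0 -> u = 1 :: map succn (ptail u).
Proof.
move=> uFin; have du := allP dF _ uFin; rewrite (ptailK du).
have [_ /(_ 0 isT)] := dsetP _ _ du; have := dset_size du.
by rewrite /hgt; case: u {uFin du} => //= x u _ x0 _ h; congr cons; lia.
Qed.

Lemma upper_part_uniq : uniq A.
Proof.
rewrite map_inj_in_uniq ?filter_uniq // => u v.
rewrite !mem_filter => /andP[_ uFin] /andP[_ vFin] e.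
by rewrite -[u]map_prednK ?(dset_pos (allP dF _ uFin)) // e
     map_prednK ?(dset_pos (allP dF _ vFin)).
Qed.

Lemma upper_part_dset : all (dset d.+1) A.
Proof.
apply/allP=> x /mapP[u]; rewrite mem_filter => /andP[hu uFin] ->.
exact: map_predn_dset (allP dF _ uFin) hu.
Qed.

Lemma low_part_uniq : uniq B.
Proof.
rewrite map_inj_in_uniq ?filter_uniq // => u v.
rewrite !mem_filter => /andP[/eqP hu uFin] /andP[/eqP hv vFin] e.
by rewrite (low_part_cons uFin hu) (low_part_cons vFin hv) e.
Qed.

Lemma low_part_dset : all (dset d) B.
Proof.
apply/allP=> x /mapP[u]; rewrite mem_filter => /andP[hu uFin] ->.
exact: ptail_dset (allP dF _ uFin).
Qed.

Lemma size_parts : size A + size B = size F.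
Proof.
rewrite !size_map !size_filter -(count_predC (fun u => 0 < hgt u) F).
by congr (_ + _); apply: eq_count => u /=; lia.
Qed.

(** The full shifts of [F] have first entry above 1. Increments of the sets starting with 1 that
    keep this 1 are disjoint from them and correspond to [incs B]. *)
Lemma size_incs_low_part : size F + size (incs B) <= size (incs F).
Proof.
rewrite -(size_map (inc 0) F) -(size_map (fun w => 1 :: map succn w) (incs B)).
rewrite -size_cat; apply: uniq_leq_size.
  rewrite cat_uniq; apply/and3P; split.
  - rewrite map_inj_in_uniq // => u v uFin vFin.
    by apply: (@inc_inj d.+1); apply: dset_size; apply: (allP dF).
  - apply/hasPn=> _ /mapP[w _ ->]; apply/negP=> /mapP[u uFin /(congr1 hgt)].
    by rewrite (hgt_inc _ (allP dF _ uFin)) //= addn1.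
  rewrite map_inj_uniq ?undup_uniq // => u v [].
  exact: (inj_map succn_inj).
move=> w; rewrite mem_cat => /orP[/mapP[u uFin ->]|/mapP[y]].
  by apply/mem_incs; exists u, 0.
case/mem_incs=> z [j [/mapP[u]]]; rewrite mem_filter => /andP[/eqP hu uFin] -> jd -> ->.
have du := allP dF _ uFin.
apply/mem_incs; exists u, j.+1; split=> //.
  by move: jd; rewrite (dset_size du) (dset_size (ptail_dset du)).
rewrite [in RHS](low_part_cons uFin hu).
apply: (@eq_from_nth _ 0) => [|l]; first by rewrite [RHS]size_inc /= !(size_map, size_inc).
rewrite /= size_map size_inc; case: l => [|l]; rewrite ltnS => lu.
  by rewrite nth_inc.
rewrite [RHS]nth_inc ?[LHS]/=; last by rewrite /= size_map.
rewrite [LHS](nth_map 0) ?size_inc // [nth 0 (_ :: _) _](nth_map 0) // nth_inc // ltnS.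
by case: ifP.
Qed.

(** Increasing [u - 1] from position [j] on amounts to lowering the first [j] entries of [u] by 1,
    so the result stays in [F] by stability. *)
Lemma incs_upper_part : stable d.+1 F -> size (incs A) <= size F.
Proof.
move=> /allP st; apply: uniq_leq_size; first exact: undup_uniq.
move=> w /mem_incs[v [j [/mapP[u]]]]; rewrite mem_filter => /andP[hu uFin] -> + ->.
rewrite size_map (dset_size (allP dF _ uFin)) => jd.
have up := dset_pos (allP dF _ uFin).
case: (posnP j) => j0; first by rewrite j0 inc0 map_prednK.
have /st/allP/(_ _ uFin) : j \in iota 1 d.+1 by rewrite mem_iota j0 ltnS.
rewrite hu /=; congr (_ \in F).
apply: (@eq_from_nth _ 0) => [|l]; rewrite ?size_inc size_slide ?size_map // => lu.
rewrite nth_slide // nth_inc ?size_map // (nth_map 0) //.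
by have /= := all_nthP 0 up l lu; case: (ltnP l j) => _; lia.
Qed.

(** Since [rk (map succn u)] is the size of [F] plus [rk (map succn (ptail u))], [coreB] finishes
    when [B] has more than [rk (ptail u)] members. Otherwise [A] is so large that [coreA] gives
    [incs A] more members than [F], against stability. *)
Lemma rk_incs_stable u :
  (forall y, dset d y -> rk y < size B -> rk (map succn y) < size (incs B)) ->
  (forall w, dset d.+1 w -> rk w < size A -> rk (map succn w) < size (incs A)) ->
  stable d.+1 F -> dset d.+1 u -> (rk u).+1 = size F ->
  rk (map succn u) < size (incs F).
Proof.
move=> coreB coreA st du ru; apply: leq_trans size_incs_low_part.
rewrite -ru (rk_map_succn du) -(ptailK du).
have dy := ptail_dset du.
suff /(coreB _ dy) : rk (ptail u) < size B by lia.
rewrite ltnNge; apply/negP=> Bsmall.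
have IA := incs_upper_part st; have sp := size_parts.
have us := dset_size du; have [_ up ui] := dsetP _ _ du.
case: (posnP (hgt u)) => hu; last first.
  set w := map predn u.
  have dw : dset d.+1 w by apply: map_predn_dset.
  have wK : map succn w = u by rewrite /w map_prednK // (dset_pos du).
  have rw := rk_map_succn dw.
  rewrite wK /w behead_map -/(ptail u) -/w in rw.
  (* Using [w] itself would only give [incs A] at least as many members as [F]; the next rank also
     fits below the size of [A] and gives strictly more. *)
  have [w' dw' rw'] := rk_surj (rk w).+1 (ltn0Sn d).
  have /(coreA _ dw') : rk w' < size A by rewrite rw'; lia.
  have := rk_map_succn_ltn dw dw'; rewrite wK rw' => /(_ (ltnSn _)).
  by lia.
(* Here [u - 1] is not a set of positive integers: decrease only the entries after
   the initial run 1, 2, ..., m. *)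
pose w := mkseq (fun l => maxn (nth 0 u l).-1 l.+1) d.+1.
have ws : size w = d.+1 by rewrite size_mkseq.
have nw l : l < d.+1 -> nth 0 w l = maxn (nth 0 u l).-1 l.+1.
  by move=> ld; rewrite nth_mkseq.
clearbody w; have dw : dset d.+1 w.
  apply/dsetP; split=> // l ld; rewrite !nw //; try lia.
  by have := ui l ld; have := up l; lia.
have lew : rk w + rk (ptail u) <= rk u.
  rewrite /rk us ws (dset_size dy) !big_ord_recl /= nw // bin1.
  have -> : (maxn (nth 0 u 0).-1 1).-1 = 0 by move: hu; rewrite /hgt; lia.
  rewrite add0n -big_split /=; apply: leq_trans (leq_addl _ _).
  apply: leq_sum => l _; rewrite /bump /= !add1n.
  have ld := ltn_ord l.
  rewrite nw // (nth_map 0) ?size_behead ?us // nth_behead.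
  have := dset_nth_ge du (ld : l.+1 < d.+1); have := up 0 isT.
  case: (nth 0 u l.+1) => [|[|x]] /=; [lia | lia |] => u0 ux.
  (* Within the initial run both binomials on the left vanish; beyond it the inequality is Pascal's
     rule. *)
  have [xl|xl] := leqP x l.
    by rewrite !bin_small //; lia.
  by rewrite binS leq_add2r; apply: leq_bin2l; lia.
have ltw : rk u < rk (map succn w).
  rewrite /rk size_map us ws !big_ord_recl /=.
  have -> : (nth 0 u 0).-1 = 0 by [].
  rewrite bin1 add0n (nth_map 0) ?ws // bin1 nw //.
  have := up 0 isT; move: hu; rewrite /hgt => hu0 up0.
  rewrite -add1n; apply: leq_add; first by lia.
  apply: leq_sum => l _; have ld := ltn_ord l; apply: leq_bin2l.
  by rewrite /bump /= !add1n (nth_map 0) ?ws // nw //; lia.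
have /(coreA _ dw) : rk w < size A by lia.
by lia.
Qed.

End Stable.

Theorem rk_incs d (F : seq (seq nat)) u : uniq F -> all (dset d) F ->
  dset d u -> rk u < size F -> rk (map succn u) < size (incs F).
Proof.
elim: d F u => [|d IHd] F u uF dF du ru.
  have /size0nil -> := dset_size du; rewrite /rk big_ord0.
  case: F {uF} dF ru => //= v F _ _.
  have : inc 0 v \in incs (v :: F) by apply/mem_incs; exists v, 0; rewrite mem_head.
  by case: (incs _).
(* For fixed [d], induction on the sum of heights serves both the passage to [A] and line
   compression. *)
have [n] := ubnP (\sum_(v <- F) hgt v).
elim: n F u uF dF du ru => // n IH F u uF dF du ru; rewrite ltnS => sn.
(* The shift is monotone in the rank, so only the largest admissible rank matters. *)
have [v dv rv] := rk_surj (size F).-1 (ltn0Sn d).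
apply: (@leq_ltn_trans (rk (map succn v))).
  by apply: (rk_map_succn_leq du dv); lia.
case: (boolP (stable d.+1 F)) => [st|].
  apply: (rk_incs_stable uF dF _ _ st dv); last by lia.
    by move=> y dy; apply: IHd (low_part_uniq uF dF) (low_part_dset dF) dy.
  (* The bound on [rk w] makes the upper part nonempty. Each of its members has lost one unit of
     height, so the sum is smaller. *)
  move=> w dw rw; apply: IH => //.
  - exact: (upper_part_uniq uF dF).
  - exact: (upper_part_dset dF).
  move: rw; rewrite size_map size_filter => /(leq_ltn_trans (leq0n _)).
  rewrite -has_count => /hasP[x xF hx].
  have hp y : y \in F -> hgt (map predn y) = (hgt y).-1.
    by move=> yF; rewrite /hgt (nth_map 0) // (dset_size (allP dF _ yF)).
  apply: leq_trans sn; rewrite big_map; set s := filter _ _.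
  have sF : {subset s <= F} by move=> y; rewrite mem_filter => /andP[].
  have xs : x \in s by rewrite mem_filter hx.
  have us : uniq s by apply: filter_uniq.
  apply: (@leq_trans (\sum_(y <- s) hgt y)); last first.
    by rewrite big_filter [X in _ <= X](bigID (fun y => 0 < hgt y)) leq_addr.
  rewrite (bigD1_seq x) //= [X in _ < X](bigD1_seq x) //=.
  rewrite hp // -addSn prednK // leq_add2l !(big_seq_cond (fun y => y != x)).
  by apply: leq_sum => y /andP[ys _]; rewrite hp ?leq_pred ?sF.
(* A failure of stability supplies a direction [i] in which compression lowers the sum of
   heights. *)
case/allPn=> i; rewrite mem_iota add1n ltnS => /andP[i0 le_i_d].
case/allPn=> x xF; rewrite negb_imply => /andP[hx nx].
apply: leq_trans (size_incs_lcomp (ltn0Sn d) i0 le_i_d uF dF).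
apply: IH => //.
- exact: (lcomp_uniq (ltn0Sn d) i0 uF dF).
- exact: (all_dset_lcomp _ dF).
- by rewrite size_lcomp; lia.
by apply: leq_trans sn; apply: (sum_hgt_lcomp (ltn0Sn d) i0 uF dF xF).
Qed.

(** * Maps of [Inc1] and the inclusion of families *)

Lemma Inc1_dset d u pi : Inc1 pi -> dset d u -> dset d (map pi u).
Proof.
move=> Pi /dsetP[du up us].
have mono x y : 0 < x -> x < y -> pi x < pi y.
  move=> x0; elim: y => // y IH; rewrite ltnS leq_eqVlt => /orP[/eqP <-|xy].
    by case: (Pi _ x0).
  by apply: ltn_trans (IH xy) _; case: (Pi y) => //; lia.
apply/dsetP; rewrite size_map; split=> // l ld.
  by rewrite (nth_map 0) ?du //; case: (Pi _ (up _ ld)).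
by rewrite !(nth_map 0) ?du //; try lia; apply: mono (us _ ld); apply: up; lia.
Qed.

Lemma inc_IncP F d j u : all (dset d) F -> u \in F -> j <= d ->
  IncP (fun v => v \in F) (inc j u).
Proof.
move=> dF uF jd; have /dsetP[du up us] := allP dF _ uF.
(* The guard [j < d] makes [pi] the identity when [j = d]; there the default value 0 of [nth] would
   otherwise shift everything. *)
pose pi x := x + ((j < d) && (nth 0 u j <= x)).
exists u, pi; split=> //; first by move=> x x0; rewrite /pi; split; lia.
apply: (@eq_from_nth _ 0) => [|l]; rewrite size_inc ?size_map // => lu.
rewrite nth_inc // (nth_map 0) // /pi.
have mono a b : a <= b -> b < d -> nth 0 u a <= nth 0 u b.
  elim: b => [|b IH]; first by rewrite leqn0 => /eqP ->.
  rewrite leq_eqVlt => /orP[/eqP -> //|ab] bd.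
  by apply: leq_trans (IH ab (ltnW bd)) _; apply/ltnW/us.
rewrite du in lu; case: (leqP j l) => jl.
  by have := mono _ _ jl lu; lia.
by case: (ltnP j d) => [jd'|]; [have := mono _ _ jl jd'; have := us l; lia | lia].
Qed.

Theorem theorem3p5 (d : nat) (F : seq (seq nat)) :
  1 <= d -> uniq F -> all (dset d) F ->
  forall G : seq (seq nat),
    enumerates (IncP (fun u => u \in F)) G ->
    forall u, IncP (compression d (size F)) u -> compression d (size G) u.
Proof.
move=> d0 uF dF G [uG memG] u [v [pi [cv Pi ->]]].
have [dv rv] := compression_rk d0 cv; have du := Inc1_dset Pi dv.
apply: rk_compression => //.
(* Maps of [Inc1] raise an entry by at most 1, so the full shift bounds every increment of [v]. *)
apply: (@leq_ltn_trans (rk (map succn v))).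
  apply: rk_leq_nth; rewrite !size_map // => l lv; rewrite !(nth_map 0) //.
  have [sv vp _] := dsetP _ _ dv.
  by case: (Pi (nth 0 v l)) => //; apply: vp; rewrite -sv.
apply: (leq_trans (rk_incs uF dF dv rv)); apply: uniq_leq_size.
  exact: undup_uniq.
move=> w /mem_incs[x [j [xF jx ->]]]; apply/memG; apply: (inc_IncP dF) => //.
by rewrite -(dset_size (allP dF _ xF)).
Qed.
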